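(* Let $a>\lambda>0$, $T>t_0\ge 0$ and $x_0\in[-1,1]$. Then problem $(FP_3)$ has a $W^{1,1}$ global minimizer.
   Context: Given constants $a>\lambda>0$, $T>t_0\ge 0$ and $x_0\in[-1,1]$, $(FP_3)$ denotes the optimal control problem: minimize $J(x,u)=\int_{t_0}^{T}\big[-e^{-\lambda t}(x(t)+u(t))\big]\,dt$ over $x\in W^{1,1}([t_0,T],\mathbb{R})$ (absolutely continuous functions) and measurable $u:[t_0,T]\to\mathbb{R}$ satisfying $\dot x(t)=-a u(t)$ for a.e. $t\in[t_0,T]$; $x(t_0)=x_0$; $u(t)\in[-1,1]$ for a.e. $t\in[t_0,T]$; and $-1\le x(t)\le 1$ for all $t\in[t_0,T]$. Such a pair $(x,u)$ is called a feasible process. A feasible process $(\bar x,\bar u)$ is a $W^{1,1}$ global minimizer if $J(\bar x,\bar u)\le J(x,u)$ for every feasible process $(x,u)$. *)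

(* Defs.v *)
From HB Require Import structures.
From mathcomp Require Import all_boot all_order all_algebra.
From mathcomp Require Import all_classical all_reals all_analysis.
Set Implicit Arguments.
Unset Strict Implicit.
Unset Printing Implicit Defensive.
Import Order.TTheory GRing.Theory Num.Theory.
Import numFieldNormedType.Exports.
Local Open Scope classical_set_scope.
Local Open Scope ring_scope.

(* The library's canonical sigma-algebra on R is the Borel one. Controls are
   Lebesgue measurable functions, so we work with the completed Lebesgue measure
   on R equipped with the sigma-algebra of its Caratheodory measurable sets. *)
Definition lebesgueR (R : realType) :=
  caratheodory_type (@wlength R idfun)^*%mu.

Local Notation leb R := (@completed_lebesgue_measure R).

(* Endpoints may be shared and intervals may be degenerate: only the open
   intervals ]l i, r i[ are required to be pairwise disjoint. *)
Definition absolutely_continuous (R : realType) (a b : R) (f : R -> R) : Prop :=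
  forall e : R, 0 < e -> exists2 d : R, 0 < d &
    forall (n : nat) (l r : 'I_n -> R),
      (forall i, [/\ a <= l i, l i <= r i & r i <= b]) ->
      trivIset [set: 'I_n] (fun i => `]l i, r i[%classic) ->
      \sum_(i < n) (r i - l i) < d ->
      \sum_(i < n) `|f (r i) - f (l i)| < e.

Section FP3.
Context {R : realType}.

(* x and u are functions on [t0, T], represented by total functions whose values
   outside [t0, T] are irrelevant (the derivative of x at the two endpoints does
   depend on them, but {t0, T} is a null set). *)
Definition FP3_feasible (a t0 T x0 : R) (x u : R -> R) : Prop :=
  [/\ absolutely_continuous t0 T x,
      measurable_fun (`[t0, T]%classic : set (lebesgueR R)) u,
      {ae leb R, forall t : R, t \in `[t0, T] -> is_derive t 1 x (- a * u t)},
      x t0 = x0 &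
      {ae leb R, forall t : R, t \in `[t0, T] -> u t \in `[-1, 1]} /\
      (forall t : R, t \in `[t0, T] -> -1 <= x t <= 1)].

Definition FP3_cost (lambda t0 T : R) (x u : R -> R) : \bar R :=
  (\int[leb R]_(t in `[t0, T]) (- expR (- lambda * t) * (x t + u t))%:E)%E.

Definition FP3_W11_global_minimizer (a lambda t0 T x0 : R)
    (x u : R -> R) : Prop :=
  FP3_feasible a t0 T x0 x u /\
  forall y v : R -> R, FP3_feasible a t0 T x0 y v ->
    (FP3_cost lambda t0 T x u <= FP3_cost lambda t0 T y v)%E.

End FP3.

(* Main.v *)
Require Import Defs.
From mathcomp Require Import all_boot all_order all_algebra.
From mathcomp Require Import all_classical all_reals all_analysis.
From mathcomp Require Import measurable_realfun.
From mathcomp Require Import ring lra.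
Import Order.TTheory GRing.Theory Num.Theory.
Import numFieldNormedType.Exports.
Local Open Scope classical_set_scope.
Local Open Scope ring_scope.
Set Implicit Arguments.
Unset Strict Implicit.
Unset Printing Implicit Defensive.

Local Notation leb R := (@completed_lebesgue_measure R).

(** The control can be eliminated from the cost.  Since the derivative of
    exp (- lambda t) x(t) is exp (- lambda t) (- a u(t) - lambda x(t)) almost
    everywhere, the fundamental theorem of calculus gives, for every feasible
    process,
<<
    J(x, u) = (exp (- lambda T) x(T) - exp (- lambda t0) x0) / a
              - (1 - lambda / a) * int exp (- lambda t) x(t) dt
>>
    ([feasible_costE]).  As lambda < a, once the endpoint y = x(T) is fixed
    the best trajectory is the largest one.  A feasible trajectory is
    a-Lipschitz and at most 1, so it lies below the envelope
<<
    X_y(t) = min (1, x0 + a (t - t0), y + a (T - t))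
>>
    ([feasible_le_envelope]), and this envelope is itself a feasible
    trajectory whenever y can be reached ([envelope_feasible]).  The problem
    is thereby reduced to minimizing J(X_y) over y in a compact interval, and
    J(X_y) is continuous in y ([endpoint_cost_continuous]), so the extreme
    value theorem applies.

    The analytic input is the passage from an almost everywhere derivative to
    increments.  An absolutely continuous function with almost everywhere
    derivative at most C in absolute value is C-Lipschitz
    ([absolutely_continuous_lipschitz]): outside a null set the function
    grows at rate at most C + e near each point, and the null set lies in an
    open set so small that absolute continuity makes the variation there less
    than e; continuous induction along the interval glues these two local
    bounds.  A Lipschitz function is then the integral of its derivative
    ([lipschitz_FTC]) by dominated convergence of its difference quotients. *)

(** * The completed Lebesgue measure *)

#[local] Instance ae_lebesgueR_filter (R : realType) :
  Filter (almost_everywhere (leb R)).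
Proof. exact: ae_filter_ringOfSetsType. Qed.

Lemma open_cover_negligible (R : realType) (N : set R) (e : R) :
  (leb R).-negligible N -> 0 < e ->
  exists U : set R, [/\ open U, N `<=` U & (lebesgue_measure U <= e%:E)%E].
Proof.
move=> [A [mA A0 NA]] e0.
have [U [oU NU Ue]] := @outer_measure_open_le R N _ e0.
exists U; split => //; apply: (le_trans Ue).
suff -> : ((wlength idfun)^*%mu N = 0)%E by rewrite add0e.
by apply/eqP; rewrite eq_le outer_measure_ge0 andbT -A0 le_outer_measure.
Qed.

Lemma measurable_id_lebesgueR (R : realType) (D : set (lebesgueR R)) :
  measurable_fun D (id : lebesgueR R -> measurableTypeR R).
Proof.
move=> mD Y mY; apply: measurableI => //; rewrite preimage_id.
exact: sub_caratheodory.
Qed.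

Lemma measurable_lebesgueR (R : realType) (D : set R) :
  measurable D -> measurable (D : set (lebesgueR R)).
Proof. exact: sub_caratheodory. Qed.

Lemma measurable_fun_lebesgueR (R : realType) (D : set R) (f : R -> R) :
  measurable_fun [set: R] f -> measurable_fun (D : set (lebesgueR R)) f.
Proof.
move=> mf.
apply: (@measurableT_comp _ _ _ (lebesgueR R) (measurableTypeR R) R f) => //.
exact: measurable_id_lebesgueR.
Qed.

Lemma leb_itv_lty (R : realType) (a b : R) : (leb R `[a, b] < +oo)%E.
Proof.
have -> : leb R `[a, b] = lebesgue_measure `[a, b]%classic by [].
by rewrite lebesgue_measure_itv/=; case: ifP => // _; rewrite -EFinB ltry.
Qed.

Lemma continuous_integrable_lebesgueR (R : realType) (a b : R) (f : R -> R) :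
  continuous f ->
  (leb R).-integrable (`[a, b]%classic : set (lebesgueR R)) (EFin \o f).
Proof.
move=> cf; apply: measurable_bounded_integrable => //.
- exact: measurable_lebesgueR.
- exact: leb_itv_lty.
- apply: measurable_fun_lebesgueR; exact: continuous_measurable_fun.
- have cf' : {within `[a, b], continuous f} by exact: continuous_subspaceT.
  have /compact_bounded[M [_ fM]] :=
    continuous_compact cf' (@segment_compact _ a b).
  by exists M; split; rewrite ?num_real // => ? ? ? ?; exact: fM.
Qed.

(** The Borel Lebesgue measure is the image of its completion under the
    identity, so the change of variables formula applies. *)
Lemma integral_lebesgueR (R : realType) (a b : R) (f : R -> R) :
  continuous f ->
  (\int[leb R]_(t in `[a, b]) (f t)%:E =
   \int[lebesgue_measure]_(t in `[a, b]) (f t)%:E)%E.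
Proof.
move=> cf.
have mD : measurable `[a, b]%classic by exact: measurable_itv.
have mf : measurable_fun [set: measurableTypeR R] (EFin \o f).
  by apply/measurable_EFinP; exact: continuous_measurable_fun.
have intf := continuous_integrable_lebesgueR a b cf.
exact/esym/(@integral_pushforward _ _ (lebesgueR R) (measurableTypeR R) R id
  (@measurable_id_lebesgueR R setT) (leb R) `[a, b]%classic _ mf intf mD).
Qed.

(** * Absolutely continuous functions with bounded derivative *)

Lemma is_derive_linear_approx (R : realType) (f : R -> R) (c d e : R) :
  is_derive c 1 f d -> 0 < e ->
  exists2 eta, 0 < eta &
    forall s, `|s - c| < eta -> `|f s - f c - d * (s - c)| <= e * `|s - c|.
Proof.
move=> [dfc dfE] e0.
have cvgd : h^-1 *: (f (h *: 1 + c) - f c) @[h --> 0^'] --> d.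
  by rewrite -dfE; exact: dfc.
have /cvgrPdist_lt/(_ _ e0)[eta /= eta0 near_d] := cvgd.
exists eta => // s sc.
have [->|sNc] := eqVneq s c; first by rewrite !subrr !(mulr0, subr0, normr0).
have h0 : s - c != 0 by rewrite subr_eq0.
have := near_d (s - c); rewrite /ball_/= sub0r normrN => /(_ sc h0).
rewrite scaler1 subrK => /ltW near_e.
rewrite (_ : f s - f c - d * (s - c) =
  - (d - (s - c)^-1 *: (f s - f c)) * (s - c)).
  by rewrite normrM normrN ler_wpM2r.
by rewrite /GRing.scale/=; field.
Qed.

(** Only steps across [c], from some [s <= c] to some [t >= c], are asked for:
    this is all that a derivative at [c], or an open neighborhood of [c],
    controls.  The supremum of the good points is approximated from the left
    by a good point, and one step goes past it. *)
Lemma segment_continuous_induction (R : realType) (a b : R) (P : R -> Prop) :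
  a <= b -> P a ->
  (forall c, a <= c <= b -> exists2 eta, 0 < eta &
     forall s t, a <= s -> s <= c <= t -> t <= b ->
       c - eta < s -> t < c + eta -> P s -> P t) ->
  P b.
Proof.
move=> ab Pa step.
pose S := [set t | a <= t <= b /\ P t].
have Sa : S a by split=> //; rewrite lexx.
have ubS : ubound S b by move=> t [/andP[_]].
have supS : has_sup S by split; [exists a | exists b].
have cab : a <= sup S <= b.
  rewrite ge_sup//=; last by exists a.
  by rewrite andbT; exact: ub_le_sup (ex_intro _ b ubS) _ Sa.
have [eta eta0 stepc] := step _ cab.
have [s [/andP[as_ sb] Ps] cs] := sup_adherent eta0 supS.
have sc : s <= sup S.
  by apply: ub_le_sup; [exists b|split=> //; rewrite as_].
pose t := Num.min b (sup S + eta / 2).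
have ct : sup S <= t.
  by case/andP: cab => _ cb; rewrite le_min cb lerDl divr_ge0 ?ltW.
have tb : t <= b by rewrite ge_min lexx.
have tc : t < sup S + eta.
  by rewrite gt_min ltrD2l ltr_pdivrMr// ltr_pMr// ltr1n orbT.
have Pt : P t by apply: (stepc s) => //; rewrite sc.
have St : S t by split=> //; rewrite tb (le_trans _ ct)//; case/andP: cab.
suff <- : t = b by [].
apply/eqP; rewrite eq_le tb leNgt; apply/negP => tltb.
have tE : t = sup S + eta / 2.
  have [bs|/ltW/min_r//] := leP b (sup S + eta / 2).
  by move: tltb; rewrite /t (min_l bs) ltxx.
have : t <= sup S by apply: ub_le_sup => //; exists b.
by rewrite leNgt tE ltrDl divr_gt0.
Qed.

Lemma measure_openI_segment (R : realType) (U : set R) (a s t : R) :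
  open U -> a <= s -> s <= t -> `[s, t] `<=` U ->
  (lebesgue_measure (U `&` `[a, s]) + (t - s)%:E <=
   lebesgue_measure (U `&` `[a, t]))%E.
Proof.
move=> oU as_ st stU.
have mU : measurable U by exact: open_measurable.
have -> : ((t - s)%:E = lebesgue_measure `]s, t]%classic)%E.
  rewrite lebesgue_measure_itv/= lte_fin; case: ltP => // ts.
  by rewrite (_ : t - s = 0) //; apply/eqP; rewrite subr_eq0 eq_le ts st.
rewrite -measureU//=.
- apply: le_measure; rewrite ?inE/=.
  + by apply: measurableU => //; exact: measurableI.
  + exact: measurableI.
  + move=> x [[Ux]|] /=; rewrite ?in_itv/= => /andP[ax xs].
      by split=> //=; rewrite ?in_itv/= ax (le_trans xs).
    split; first by apply: stU; rewrite /= ?in_itv/= (ltW ax).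
    by rewrite /= ?in_itv/= xs (le_trans as_)// ltW.
- exact: measurableI.
- rewrite -subset0 => x [[_]] /=; rewrite ?in_itv/= => /andP[_ xs] /andP[sx _].
  by move: (lt_le_trans sx xs); rewrite ltxx.
Qed.

(** Continuous induction on [t], carrying a finite disjoint family of
    subintervals of [`[a, t]] whose total length is at most the measure of
    [U `&` `[a, t]], where [U] is a small open neighborhood of the exceptional
    null set, and such that the growth of [f] beyond slope [C + e] is paid for
    by its increments over the family.  A step across a point of [U] adds one
    interval to the family; a step across any other point uses the derivative.
    Since [C >= 0], the linear term does not decrease on the first kind of
    step. *)
Lemma absolutely_continuous_le (R : realType) (a b C : R) (f : R -> R) :
  a <= b -> 0 <= C -> absolutely_continuous a b f ->
  {ae leb R, forall t : R, t \in `[a, b] ->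
    exists2 d, is_derive t 1 f d & d <= C} ->
  f b - f a <= C * (b - a).
Proof.
move=> ab C0 acf [N0 [mN0 N00 sN0]].
set N := ~` _ in sN0.
have negN : (leb R).-negligible N by exists N0.
(* The error is [e (b - a + 1)], and [e] is arbitrary. *)
suff main e : 0 < e -> f b - f a <= (C + e) * (b - a) + e.
  apply/ler_addgt0Pr => e e0.
  have k0 : 0 < b - a + 1 by rewrite ltr_wpDl ?subr_ge0.
  have := main (e / (b - a + 1)) (divr_gt0 e0 k0); move=> /le_trans; apply.
  rewrite mulrDl -addrA lerD2l -[X in _ + X]mulr1 -mulrDr.
  by rewrite -mulrA mulVf ?mulr1// gt_eqF.
move=> e0; have [d d0 acd] := acf _ e0.
have d20 : 0 < d / 2 by rewrite divr_gt0.
have [U [oU NU Ud]] := open_cover_negligible negN d20.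
pose P t := exists n, exists l r : 'I_n -> R,
  [/\ forall i, [/\ a <= l i, l i <= r i & r i <= t],
      trivIset [set: 'I_n] (fun i => `]l i, r i[%classic),
      ((\sum_(i < n) (r i - l i))%:E <=
         lebesgue_measure (U `&` `[a, t]))%E &
      f t - f a <= (C + e) * (t - a) + \sum_(i < n) `|f (r i) - f (l i)|].
suff [n [l [r [lr triv lenlr fb]]]] : P b.
  apply: (le_trans fb); rewrite lerD2l ltW// acd//.
  rewrite -lte_fin; apply: (le_lt_trans lenlr).
  apply: (@le_lt_trans _ _ (d / 2)%:E).
    apply: le_trans Ud; apply: le_measure; rewrite ?inE/=.
    + apply: measurableI => //; exact: open_measurable.
    + exact: open_measurable.
    + by move=> x [].
  by rewrite lte_fin ltr_pdivrMr// ltr_pMr// ltr1n.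
apply: (segment_continuous_induction ab).
  exists 0, (fun=> 0), (fun=> 0); split.
  - by case.
  - by case.
  - by rewrite big_ord0 measure_ge0.
  - by rewrite big_ord0 !subrr mulr0 addr0.
move=> c /andP[ac cb].
have [Nc|Nc] := pselect (N c).
- have [eta /= eta0 etaU] := oU _ (NU _ Nc).
  exists eta => // s t as_ /andP[sc ct] tb cs tc [n [l [r [lr triv len fs]]]].
  have st : s <= t := le_trans sc ct.
  (* The interval ]s, t[ is put in front, at index [ord0]. *)
  pose ext (x : R) (g : 'I_n -> R) (i : 'I_n.+1) :=
    if unlift ord0 i is Some j then g j else x.
  have ext0 x g : ext x g ord0 = x by rewrite /ext unlift_none.
  have extS x g j : ext x g (lift ord0 j) = g j by rewrite /ext liftK.
  exists n.+1, (ext s l), (ext t r); split.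
  + move=> i; case: (unliftP ord0 i) => [j|] ->; rewrite ?ext0 ?extS//.
    by have [alj ljr rs] := lr j; split=> //; exact: le_trans st.
  + have disj j : `]s, t[%classic `&` `]l j, r j[%classic = set0.
      rewrite -subset0 => x []/=; rewrite ?in_itv/= => /andP[sx _] /andP[_ xr].
      have [_ _ rs] := lr j.
      by have := lt_le_trans (lt_trans sx xr) rs; rewrite ltxx.
    apply/trivIsetP => i j _ _.
    case: (unliftP ord0 i) => [i'|] ->; case: (unliftP ord0 j) => [j'|] -> //;
      rewrite ?ext0 ?extS.
    * rewrite (inj_eq lift_inj) => ij.
      by move/trivIsetP: triv; apply.
    * by rewrite setIC.
    * by [].
  + rewrite big_ord_recl !ext0.
    under eq_bigr do rewrite !extS.
    rewrite addrC EFinD. apply: le_trans (measure_openI_segment oU as_ st _).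
      by rewrite leeD2r.
    move=> x /=; rewrite ?in_itv/= => /andP[sx xt]; apply: etaU => /=.
    by rewrite ltr_distlC; lra.
  + rewrite big_ord_recl !ext0.
    under [X in _ + (_ + X)]eq_bigr do rewrite !extS.
    set S := \sum_(_ < _) _ in fs *.
    have Ce : 0 <= (C + e) * (t - s).
      by apply: mulr_ge0; [rewrite addr_ge0// ltW|rewrite subr_ge0].
    have := ler_norm (f t - f s); lra.
- have ctab : c \in `[a, b] by rewrite in_itv/= ac cb.
  have [d' df dC] := @contrapT (_ -> exists2 d, _ & _) Nc ctab.
  have [eta eta0 lin] := is_derive_linear_approx df e0.
  exists eta => // s t as_ /andP[sc ct] tb cs tc [n [l [r [lr triv len fs]]]].
  have st : s <= t := le_trans sc ct.
  exists n, l, r; split=> //.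
  + by move=> i; have [? ? ?] := lr i; split=> //; exact: le_trans st.
  + apply: (le_trans len); apply: le_measure; rewrite ?inE/=.
    * by apply: measurableI => //; exact: open_measurable.
    * by apply: measurableI => //; exact: open_measurable.
    * by apply: setIS; apply: subset_itvl; rewrite bnd_simp.
  + have := lin s; have := lin t.
    rewrite (ger0_norm (_ : 0 <= t - c)) ?subr_ge0//.
    rewrite (ler0_norm (_ : s - c <= 0)) ?subr_le0//.
    have -> : t - c < eta by lra.
    have -> : - (s - c) < eta by lra.
    move=> /(_ isT) lint /(_ isT) lins.
    have := le_trans (ler_norm _) lint; move: lins; rewrite distrC.
    move=> /(le_trans (ler_norm _)).
    have : d' * (t - s) <= C * (t - s) by rewrite ler_wpM2r ?subr_ge0.
    set S := \sum_(_ < _) _ in fs *; lra.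
Qed.

Lemma absolutely_continuous_sub (R : realType) (a b a' b' : R) (f : R -> R) :
  a <= a' -> b' <= b -> absolutely_continuous a b f ->
  absolutely_continuous a' b' f.
Proof.
move=> aa' b'b acf e e0; have [d d0 acd] := acf e e0.
exists d => // n l r lr; apply: acd => i.
have [al lr' rb] := lr i.
by split => //; [exact: le_trans al|exact: le_trans b'b].
Qed.

Lemma absolutely_continuousN (R : realType) (a b : R) (f : R -> R) :
  absolutely_continuous a b f -> absolutely_continuous a b (- f).
Proof.
move=> acf e e0; have [d d0 acd] := acf e e0.
exists d => // n l r lr triv len; apply: le_lt_trans (acd n l r lr triv len).
by apply: ler_sum => i _; rewrite opprK addrC distrC.
Qed.

Lemma absolutely_continuous_lipschitz (R : realType) (a b C : R) (f : R -> R) :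
  0 <= C -> absolutely_continuous a b f ->
  {ae leb R, forall t : R, t \in `[a, b] ->
    exists2 d, is_derive t 1 f d & `|d| <= C} ->
  {in `[a, b] &, forall s t, `|f s - f t| <= C * `|s - t|}.
Proof.
move=> C0 acf df s t; rewrite !in_itv/=.
wlog st : s t / s <= t.
  move=> H; have [/H //|/ltW/H H' ? ?] := leP s t.
  by rewrite distrC [X in C * X]distrC; exact: H'.
move=> /andP[as_ sb] /andP[at_ tb].
rewrite distrC [X in C * X]distrC (ger0_norm (_ : 0 <= t - s)) ?subr_ge0//.
have mono x : s <= x <= t -> x \in `[a, b].
  by move=> /andP[sx xt]; rewrite in_itv/= (le_trans as_)// (le_trans xt).
have acst := absolutely_continuous_sub as_ tb acf.
rewrite ler_norml; apply/andP; split.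
- have := @absolutely_continuous_le R s t C (- f) st C0
    (absolutely_continuousN acst).
  rewrite !fctE => H.
  suff : - f t - - f s <= C * (t - s) by lra.
  apply: H; move: df; apply: filterS => x H /mono/H[d dx dC].
  exists (- d); first exact: is_deriveN.
  by rewrite (le_trans (ler_norm _))// normrN.
- apply: absolutely_continuous_le => //.
  move: df; apply: filterS => x H /mono/H[d dx dC].
  by exists d => //; rewrite (le_trans (ler_norm _)).
Qed.

Lemma lipschitz_absolutely_continuous (R : realType) (a b C : R) (f : R -> R) :
  {in `[a, b] &, forall s t, `|f s - f t| <= C * `|s - t|} ->
  absolutely_continuous a b f.
Proof.
move=> fC e e0.
have C1 : 0 < `|C| + 1 by rewrite ltr_wpDl.
exists (e / (`|C| + 1)); first by rewrite divr_gt0.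
move=> n l r lr _; rewrite ltr_pdivlMr// mulrC; apply: le_lt_trans.
rewrite mulr_sumr; apply: ler_sum => i _.
have [al lir rb] := lr i.
apply: (le_trans (fC _ _ _ _)).
- by rewrite in_itv/= rb (le_trans al).
- by rewrite in_itv/= al (le_trans lir).
rewrite ger0_norm ?subr_ge0//; apply: ler_wpM2r; first by rewrite subr_ge0.
by apply: (le_trans (ler_norm _)); rewrite lerDl.
Qed.

(** * The fundamental theorem of calculus for Lipschitz functions *)

Lemma ae_neq_lebesgueR (R : realType) (c : R) :
  {ae leb R, forall t : R, t != c}.
Proof.
exists [set c]; split.
- exact: measurable_lebesgueR.
- have -> : leb R [set c] = lebesgue_measure [set c] by [].
  exact: lebesgue_measure_set1.
- by move=> t /= /negP; rewrite negbK => /eqP.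
Qed.

Lemma lipschitz_continuous (R : realType) (C : R) (f : R -> R) :
  (forall s t, `|f s - f t| <= C * `|s - t|) -> continuous f.
Proof.
move=> fC t; apply/cvgrPdist_lt => e e0.
have C1 : 0 < `|C| + 1 by rewrite ltr_wpDl.
exists (e / (`|C| + 1)) => /=; first by rewrite divr_gt0.
move=> s; rewrite /= ltr_pdivlMr// mulrC; apply: le_lt_trans.
apply: (le_trans (fC _ _)); apply: ler_wpM2r => //.
by apply: (le_trans (ler_norm _)); rewrite lerDl.
Qed.

Lemma is_derive_continuous (R : realType) (f : R -> R) (t d : R) :
  is_derive t 1 f d -> {for t, continuous f}.
Proof.
by move=> [df _]; apply: differentiable_continuous; apply/derivable1_diffP.
Qed.

Lemma cvg_difference_quotient (R : realType) (f : R -> R) (c d : R) :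
  is_derive c 1 f d ->
  n.+1%:R * (f (c + n.+1%:R^-1) - f c) @[n --> \oo] --> d.
Proof.
move=> df; apply/cvgrPdist_le => e e0.
have [eta eta0 lin] := is_derive_linear_approx df e0.
near=> n.
have n0 : 0 < n.+1%:R :> R by rewrite ltr0n.
have h0 : 0 < n.+1%:R^-1 :> R by rewrite invr_gt0.
have := lin (c + n.+1%:R^-1); rewrite (addrC c) addrK gtr0_norm//.
have -> : (n.+1%:R^-1 : R) < eta.
  by near: n; exact: (near_infty_natSinv_lt (PosNum eta0)).
move=> /(_ isT) H; rewrite distrC -(ler_pM2r h0); apply: le_trans H.
rewrite -[X in _ * X](gtr0_norm h0) -normrM le_eqVlt; apply/orP; left.
apply/eqP; congr (`| _ |).
by rewrite mulrBl mulrAC mulfV ?mul1r// gt_eqF.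
Unshelve. all: by end_near. Qed.

Lemma antiderivative (R : realType) (a b : R) (w : R -> R) : continuous w ->
  exists W : R -> R, forall t, a < t < b -> is_derive t 1 W (w t).
Proof.
move=> cw.
exists (fun x => \int[lebesgue_measure]_(t in `[a, x]) w t)%R.
move=> t /andP[at_ tb].
have iw : (lebesgue_measure : measure (measurableTypeR R) R).-integrable
    `[a, b] (EFin \o w).
  apply: continuous_compact_integrable; first exact: segment_compact.
  exact: continuous_subspaceT.
have [dW WE] := continuous_FTC1_closed tb iw at_ (cw t).
by split; [exact: dW|rewrite -WE derive1E].
Qed.

(** The difference quotients [q n] of [w] with step [1 / (n + 1)] are bounded by
    [C] and converge to [v] almost everywhere, so their integrals converge to
    that of [v].  With an antiderivative [W] of [w], the integral of [q n] is
    the difference quotient of [W] at [b] minus that at [a], which converges to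
    [w b - w a].  Difference quotients at points close to [b] leave [`[a, b]],
    which is why [w] is Lipschitz on the whole line here. *)
Lemma lipschitz_FTC (R : realType) (a b C : R) (w v : R -> R) :
  a < b -> (forall s t, `|w s - w t| <= C * `|s - t|) ->
  measurable_fun (`[a, b]%classic : set (lebesgueR R)) v ->
  {ae leb R, forall t : R, t \in `]a, b[ -> is_derive t 1 w (v t)} ->
  (leb R).-integrable (`[a, b]%classic : set (lebesgueR R)) (EFin \o v) /\
  (\int[leb R]_(t in `[a, b]) (v t)%:E = (w b - w a)%:E)%E.
Proof.
move=> ab wC mv dw.
have cw := lipschitz_continuous wC.
have mD : measurable (`[a, b]%classic : set (lebesgueR R)).
  exact: measurable_lebesgueR.
pose h n : R := n.+1%:R^-1.
have n0 n : 0 < n.+1%:R :> R by rewrite ltr0n.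
have h0 n : 0 < h n by rewrite invr_gt0.
pose q n t := n.+1%:R * (w (t + h n) - w t).
have cq n : continuous (q n).
  move=> t; apply: cvgM; first exact: cvg_cst.
  apply: cvgB; last exact: cw.
  apply: (@cvg_comp _ _ _ (fun t => t + h n) w); last exact: cw.
  by apply: cvgD; [exact: cvg_id|exact: cvg_cst].
have [iv _ cvg_int] : [/\
    (leb R).-integrable (`[a, b]%classic : set (lebesgueR R)) (EFin \o v),
    (\int[leb R]_(t in `[a, b]) `|(q n t)%:E - (v t)%:E|)%E
      @[n --> \oo] --> 0%E &
    (\int[leb R]_(t in `[a, b]) (q n t)%:E)%E @[n --> \oo] -->
    (\int[leb R]_(t in `[a, b]) (v t)%:E)%E].
  apply: (@dominated_convergence _ (lebesgueR R) R (leb R) `[a, b]%classic mD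
    (fun n t => (q n t)%:E) (EFin \o v) (cst C%:E)).
  - move=> n; apply/measurable_EFinP; apply: measurable_fun_lebesgueR.
    exact: continuous_measurable_fun.
  - exact/measurable_EFinP.
  - have := ae_neq_lebesgueR a; have := ae_neq_lebesgueR b; move: dw.
    apply: filterS3 => t dwt tb ta; rewrite /= in_itv/= => /andP[at_ tb'].
    apply/cvg_EFin; first by near=> n.
    apply: cvg_difference_quotient; apply: dwt.
    by rewrite in_itv/= !lt_neqAle at_ tb' tb eq_sym ta.
  - apply: (@continuous_integrable_lebesgueR R a b (cst C)) => t.
    exact: cvg_cst.
  - apply: aeW => t n _; rewrite /= lee_fin normrM gtr0_norm//.
    rewrite mulrC -ler_pdivlMr// (le_trans (wC _ _))//.
    by rewrite (addrC t) addrK gtr0_norm.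
split=> //.
(* The steps are at most 1: all the points [t + h n] lie in ]a - 1, b + 2[. *)
have [W dW] := @antiderivative R (a - 1) (b + 2) w cw.
have intq n : (\int[leb R]_(t in `[a, b]) (q n t)%:E =
    (n.+1%:R * (W (b + h n) - W b) - n.+1%:R * (W (a + h n) - W a))%:E)%E.
  rewrite integral_lebesgueR//.
  pose F t := n.+1%:R * (W (t + h n) - W t).
  have h1 : h n <= 1 by rewrite invf_le1// ler1n.
  have dF t : a <= t <= b -> is_derive t 1 F (q n t).
    move=> /andP[at_ tb].
    have dWt : is_derive t 1 W (w t) by apply: dW; lra.
    have dWth : is_derive (t + h n) 1 W (w (t + h n)).
      by apply: dW; have := h0 n; lra.
    have dsh : is_derive t 1 (fun s => s + h n) (1 + 0).
      by apply: is_deriveD.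
    have dWs : is_derive t 1 (fun s => W (s + h n)) (w (t + h n) * (1 + 0)).
      exact: (@is_derive1_comp _ W (fun s => s + h n)).
    have := is_deriveZ (n.+1%:R) (is_deriveB dWs dWt).
    by rewrite addr0 mulr1.
  have cF t : a <= t <= b -> {for t, continuous F}.
    by move=> /dF; exact: is_derive_continuous.
  rewrite (@continuous_FTC2 _ (q n) F a b ab).
  - by rewrite -EFinB.
  - exact: continuous_subspaceT.
  - split.
    + move=> t; rewrite in_itv/= => /andP[at_ tb].
      by have [] : is_derive t 1 F (q n t) by apply: dF; rewrite !ltW.
    + by apply: cvg_at_right_filter; apply: cF; rewrite lexx ltW.
    + by apply: cvg_at_left_filter; apply: cF; rewrite lexx ltW.
  - move=> t; rewrite in_itv/= => /andP[at_ tb].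
    have [_ FE] : is_derive t 1 F (q n t) by apply: dF; rewrite !ltW.
    by rewrite derive1E.
have cvg_w : (\int[leb R]_(t in `[a, b]) (q n t)%:E)%E
    @[n --> \oo] --> (w b - w a)%:E.
  under eq_cvg do rewrite intq.
  apply/cvg_EFin; first by near=> n.
  by apply: cvgB; apply: cvg_difference_quotient; apply: dW; lra.
exact: (cvg_unique _ cvg_int cvg_w).
Unshelve. all: by end_near. Qed.

Lemma near_eq_is_derive (R : realType) (f g : R -> R) (c d : R) :
  {near c, f =1 g} -> is_derive c 1 f d -> is_derive c 1 g d.
Proof.
move=> fg [df fd]; split; first exact: near_eq_derivable fg df.
by rewrite -fd; apply/esym; exact: near_eq_derive.
Qed.

(** Composing with this retraction onto [`[a, b]] extends a Lipschitz function
    from [`[a, b]] to the whole line with the same constant. *)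
Definition clamp (R : realType) (a b t : R) := Num.max a (Num.min b t).

Lemma clamp_in (R : realType) (a b t : R) : a <= b -> clamp a b t \in `[a, b].
Proof. by move=> ab; rewrite in_itv/= le_max lexx/= ge_max ab ge_min lexx. Qed.

Lemma clamp_id (R : realType) (a b t : R) : t \in `[a, b] -> clamp a b t = t.
Proof. by rewrite in_itv/= => /andP[at_ tb]; rewrite /clamp min_r// max_r. Qed.

Lemma clamp_contraction (R : realType) (a b s t : R) :
  `|clamp a b s - clamp a b t| <= `|s - t|.
Proof.
wlog st : s t / s <= t.
  move=> H; have [/H //|/ltW/H] := leP s t.
  by rewrite distrC [leRHS]distrC.
rewrite [leRHS]distrC (ger0_norm (_ : 0 <= t - s)) ?subr_ge0// ler_norml.
apply/andP; rewrite /clamp.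
by case: (leP b s) => ?; case: (leP b t) => ?; case: (leP a b) => ?;
  case: (leP a s) => ?; case: (leP a t) => ?; split; lra.
Qed.

Lemma lipschitz_comp_clamp (R : realType) (a b C : R) (f : R -> R) :
  a <= b -> 0 <= C ->
  {in `[a, b] &, forall s t, `|f s - f t| <= C * `|s - t|} ->
  forall s t, `|f (clamp a b s) - f (clamp a b t)| <= C * `|s - t|.
Proof.
move=> ab C0 fC s t; apply: (le_trans (fC _ _ _ _)); rewrite ?clamp_in//.
by apply: ler_wpM2l => //; exact: clamp_contraction.
Qed.

Lemma lipschitz_integrable (R : realType) (a b C : R) (f : R -> R) :
  a <= b -> 0 <= C ->
  {in `[a, b] &, forall s t, `|f s - f t| <= C * `|s - t|} ->
  (leb R).-integrable (`[a, b]%classic : set (lebesgueR R)) (EFin \o f).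
Proof.
move=> ab C0 fC.
have := continuous_integrable_lebesgueR a b
  (lipschitz_continuous (lipschitz_comp_clamp ab C0 fC)).
apply: eq_integrable; first exact: measurable_lebesgueR.
by move=> t; rewrite inE => tab; rewrite /= clamp_id.
Qed.

Lemma lipschitz_on_FTC (R : realType) (a b C : R) (w v : R -> R) :
  a < b -> 0 <= C ->
  {in `[a, b] &, forall s t, `|w s - w t| <= C * `|s - t|} ->
  measurable_fun (`[a, b]%classic : set (lebesgueR R)) v ->
  {ae leb R, forall t : R, t \in `[a, b] -> is_derive t 1 w (v t)} ->
  (leb R).-integrable (`[a, b]%classic : set (lebesgueR R)) (EFin \o v) /\
  (\int[leb R]_(t in `[a, b]) (v t)%:E = (w b - w a)%:E)%E.
Proof.
move=> ab C0 wC mv dw.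
have := lipschitz_FTC ab (lipschitz_comp_clamp (ltW ab) C0 wC) mv.
rewrite !clamp_id ?in_itv/= ?lexx ?ltW//; apply.
move: dw; apply: filterS => t dw tab.
have tab' : t \in `[a, b] by apply: subset_itv_oo_cc.
apply: near_eq_is_derive (dw tab').
near=> s; rewrite clamp_id//; apply: subset_itv_oo_cc.
by near: s; exact: near_in_itvoo.
Unshelve. all: by end_near. Qed.

(** * The cost as a function of the trajectory *)

Lemma continuous_discount (R : realType) (lambda : R) :
  continuous (fun t : R => expR (- lambda * t)).
Proof.
move=> t; apply: (@continuous_comp _ _ _ (fun t => - lambda * t) expR).
  by apply: cvgM; [exact: cvg_cst|exact: cvg_id].
exact: continuous_expR.
Qed.

Definition discounted_area (R : realType) (lambda t0 T : R) (x : R -> R) : R :=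
  (\int[leb R]_(t in (`[t0, T]%classic : set (lebesgueR R)))
    (expR (- lambda * t) * x t))%R.

(** For nonnegative times the discount factor is at most 1 and
    [lambda]-Lipschitz. *)
Lemma discounted_lipschitz (R : realType) (a lambda t0 T : R) (x : R -> R) :
  0 <= a -> 0 <= lambda -> 0 <= t0 ->
  {in `[t0, T] &, forall s t, `|x s - x t| <= a * `|s - t|} ->
  {in `[t0, T], forall t, `|x t| <= 1} ->
  {in `[t0, T] &, forall s t,
    `|expR (- lambda * s) * x s - expR (- lambda * t) * x t| <=
      (a + lambda) * `|s - t|}.
Proof.
move=> a0 l0 t00 xC x1 s t sI tI.
wlog st : s t sI tI / s <= t.
  move=> H; have [/H|/ltW/H H'] := leP s t; first exact.
  by rewrite distrC (distrC s t); exact: H'.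
have le1 r : r \in `[t0, T] -> expR (- lambda * r) <= 1.
  rewrite in_itv/= => /andP[t0r _].
  by rewrite expR_le1 mulNr oppr_le0 mulr_ge0// (le_trans t00).
have -> : expR (- lambda * s) * x s - expR (- lambda * t) * x t =
    expR (- lambda * s) * (x s - x t) +
    (expR (- lambda * s) - expR (- lambda * t)) * x t by ring.
apply: (le_trans (ler_normD _ _)); rewrite [leRHS]mulrDl; apply: lerD.
  rewrite normrM ger0_norm ?expR_ge0//; apply: le_trans (xC _ _ sI tI).
  by rewrite ler_piMl// le1.
rewrite normrM.
apply: (@le_trans _ _ `|expR (- lambda * s) - expR (- lambda * t)|).
  by rewrite ler_piMr// x1.
rewrite (distrC s t) (ger0_norm (_ : 0 <= t - s)) ?subr_ge0//.
rewrite ger0_norm; last first.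
  by rewrite subr_ge0 ler_expR !mulNr lerN2 ler_wpM2l.
have -> : expR (- lambda * t) =
    expR (- lambda * s) * expR (- (lambda * (t - s))).
  by rewrite -expRD; congr expR; ring.
rewrite -{1}[expR (- lambda * s)]mulr1 -mulrBr.
have h : 1 - expR (- (lambda * (t - s))) <= lambda * (t - s).
  by have := expR_ge1Dx (- (lambda * (t - s))); lra.
apply: le_trans h; rewrite ler_piMl ?le1// subr_ge0 expR_le1 oppr_le0.
by rewrite mulr_ge0// subr_ge0.
Qed.

Section feasible_processes.
Context {R : realType} (a lambda t0 T x0 : R).
Hypotheses (lambda_gt0 : 0 < lambda) (lambda_lt_a : lambda < a).
Hypotheses (t0_ge0 : 0 <= t0) (t0_lt_T : t0 < T).

Let a_gt0 : 0 < a. Proof. exact: lt_trans lambda_lt_a. Qed.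

Lemma feasible_lipschitz (x u : R -> R) :
  FP3_feasible a t0 T x0 x u ->
  {in `[t0, T] &, forall s t, `|x s - x t| <= a * `|s - t|}.
Proof.
move=> [acx _ dx _ [u1 _]].
apply: absolutely_continuous_lipschitz => //; first exact: ltW.
move: dx u1; apply: filterS2 => t dx u1 tI.
exists (- a * u t); first exact: dx.
have := u1 tI; rewrite in_itv/= -ler_norml => ut1.
by rewrite normrM normrN (gtr0_norm a_gt0) ler_piMr// ltW.
Qed.

Lemma feasible_bounded (x u : R -> R) :
  FP3_feasible a t0 T x0 x u -> {in `[t0, T], forall t, `|x t| <= 1}.
Proof. by move=> [_ _ _ _ [_ x1]] t /x1; rewrite ler_norml. Qed.

Lemma discounted_integrable (x : R -> R) :
  {in `[t0, T] &, forall s t, `|x s - x t| <= a * `|s - t|} ->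
  {in `[t0, T], forall t, `|x t| <= 1} ->
  (leb R).-integrable (`[t0, T]%classic : set (lebesgueR R))
    (EFin \o (fun t => expR (- lambda * t) * x t)).
Proof.
move=> xC x1.
apply: (@lipschitz_integrable _ _ _ (a + lambda)); first exact: ltW.
  by rewrite addr_ge0// ltW.
by apply: discounted_lipschitz => //; exact: ltW.
Qed.

(** The integrand [- exp (- lambda t) (x + u)] is [v / a - (1 - lambda / a) z],
    where [z] is the discounted trajectory and [v] its derivative. *)
Lemma feasible_costE (x u : R -> R) :
  FP3_feasible a t0 T x0 x u ->
  FP3_cost lambda t0 T x u =
  ((expR (- lambda * T) * x T - expR (- lambda * t0) * x0) / a
    - (1 - lambda / a) * discounted_area lambda t0 T x)%:E.
Proof.
move=> Fxu; have xC := feasible_lipschitz Fxu; have x1 := feasible_bounded Fxu.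
have [_ mu dx xt0 _] := Fxu.
have mD : measurable (`[t0, T]%classic : set (lebesgueR R)).
  exact: measurable_lebesgueR.
pose z t := expR (- lambda * t) * x t.
pose v t := expR (- lambda * t) * (- a * u t) - lambda * z t.
have iz := discounted_integrable xC x1.
have mz : measurable_fun (`[t0, T]%classic : set (lebesgueR R)) z.
  by apply/measurable_EFinP; exact: measurable_int iz.
have mv : measurable_fun (`[t0, T]%classic : set (lebesgueR R)) v.
  apply: measurable_funB; last exact: measurable_funM.
  apply: measurable_funM; last exact: measurable_funM.
  apply: measurable_fun_lebesgueR; apply: continuous_measurable_fun.
  exact: continuous_discount.
have al0 : 0 <= a + lambda by rewrite addr_ge0// ltW.
have zC := discounted_lipschitz (ltW a_gt0) (ltW lambda_gt0) t0_ge0 xC x1.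
have dz : {ae leb R, forall t : R, t \in `[t0, T] -> is_derive t 1 z (v t)}.
  move: dx; apply: filterS => t dx tI; have dxt := dx tI.
  have dlin : is_derive t 1 (fun t => - lambda * t) (- lambda).
    have := is_deriveZ (- lambda) (is_derive_id t (1 : R)).
    by rewrite /GRing.scale/= mulr1.
  have dexp : is_derive t 1 (fun t => expR (- lambda * t))
      (expR (- lambda * t) * - lambda).
    exact: (@is_derive1_comp _ expR (fun t => - lambda * t)).
  apply: is_derive_eq (is_deriveM dexp dxt) _.
  by rewrite /GRing.scale/= /v /z; ring.
have [iv intv] := lipschitz_on_FTC t0_lt_T al0 zC mv dz.
have intz : (\int[leb R]_(t in `[t0, T]) (z t)%:E =
    (discounted_area lambda t0 T x)%:E)%E.
  rewrite /discounted_area /Rintegral fineK//.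
  exact: integrable_fin_num.
transitivity (\int[leb R]_(t in `[t0, T])
    ((a^-1)%:E * (v t)%:E - (1 - lambda / a)%:E * (z t)%:E))%E.
  apply: eq_integral => t _; rewrite -!EFinM -EFinB; congr (_%:E).
  by rewrite /v /z; field; rewrite gt_eqF.
rewrite integralB//; [|exact: integrableZl..].
rewrite !integralZl// intv intz -!EFinM -EFinB; congr (_%:E).
by rewrite /z xt0 mulrC.
Qed.

End feasible_processes.

(** * The largest trajectory with a given endpoint *)

Lemma lipschitz_min (R : realType) (C : R) (f g : R -> R) :
  (forall s t, `|f s - f t| <= C * `|s - t|) ->
  (forall s t, `|g s - g t| <= C * `|s - t|) ->
  forall s t, `|Num.min (f s) (g s) - Num.min (f t) (g t)| <= C * `|s - t|.
Proof.
move=> fC gC s t; move: (fC s t) (gC s t); rewrite !ler_norml.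
set k := C * _ => /andP[? ?] /andP[? ?].
by apply/andP; case: (leP (f s)) => ?; case: (leP (f t)) => ?; split; lra.
Qed.

Lemma near_lt_continuous (R : realType) (f g : R -> R) (t : R) :
  {for t, continuous f} -> {for t, continuous g} -> f t < g t ->
  \forall s \near t, f s < g s.
Proof.
move=> cf cg; rewrite -subr_gt0 => fg.
have : \forall s \near t, 0 < g s - f s by exact: cvgr_gt (cvgB cg cf) _ fg.
by apply: filterS => s; rewrite subr_gt0.
Qed.

Section envelope.
Context {R : realType} (a lambda t0 T x0 : R).
Hypotheses (lambda_gt0 : 0 < lambda) (lambda_lt_a : lambda < a).
Hypotheses (t0_ge0 : 0 <= t0) (t0_lt_T : t0 < T).

Let a_gt0 : 0 < a. Proof. exact: lt_trans lambda_lt_a. Qed.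

Let rise t := x0 + a * (t - t0).
Let fall y t := y + a * (T - t).

(** Rise at full speed from [x0], stay at 1, fall at full speed to the endpoint
    [y]; some of the three phases may be empty. *)
Definition envelope (y t : R) : R :=
  Num.min (Num.min 1 (rise t)) (fall y t).

(** [- a] times this is the slope of the branch that realizes the minimum.  The
    three slopes differ, so two branches agree at three times at most, and
    these form a null set. *)
Definition envelope_control (y t : R) : R :=
  if (rise t < 1) && (rise t < fall y t) then -1
  else if fall y t < 1 then 1 else 0.

Lemma envelope_lipschitz y s t :
  `|envelope y s - envelope y t| <= a * `|s - t|.
Proof.
apply: (@lipschitz_min _ a (fun t => Num.min 1 (rise t)) (fall y)) => {s t} s t.
  apply: (@lipschitz_min _ a (fun=> 1) rise) => {s t} s t.
    by rewrite subrr normr0 mulr_ge0// ltW.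
  rewrite (_ : rise s - rise t = a * (s - t)); last by rewrite /rise; ring.
  by rewrite normrM gtr0_norm.
rewrite (_ : fall y s - fall y t = a * (t - s)); last by rewrite /fall; ring.
by rewrite normrM gtr0_norm// distrC.
Qed.

Lemma envelope_lipschitz_endpoint y z t :
  `|envelope y t - envelope z t| <= `|y - z|.
Proof.
rewrite -[leRHS]mul1r.
apply: (@lipschitz_min _ 1 (fun=> Num.min 1 (rise t)) (fall ^~ t)) => {y z} y z.
  by rewrite subrr normr0 mul1r.
by rewrite mul1r /fall (_ : _ - _ = y - z)//; ring.
Qed.

Lemma is_derive_rise (t : R) : is_derive t 1 rise a.
Proof.
have h : is_derive t 1 (cst x0 + a \*: (id - cst t0)) (0 + a *: (1 - 0)).
  by apply: is_deriveD.
by move: h; rewrite add0r subr0 /GRing.scale/= mulr1.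
Qed.

Lemma is_derive_fall (y t : R) : is_derive t 1 (fall y) (- a).
Proof.
have h : is_derive t 1 (cst y + a \*: (cst T - id)) (0 + a *: (0 - 1)).
  by apply: is_deriveD.
by move: h; rewrite add0r sub0r /GRing.scale/= mulrN1.
Qed.

(** Away from the crossing times, the smallest of the three branches stays the
    smallest nearby. *)
Lemma envelope_is_derive (y t : R) :
  rise t != 1 -> fall y t != 1 -> rise t != fall y t ->
  is_derive t 1 (envelope y) (- a * envelope_control y t).
Proof.
move=> r1 f1 rf.
have cr := is_derive_continuous (is_derive_rise t).
have cf := is_derive_continuous (is_derive_fall y t).
have c1 : {for t, continuous (fun=> 1 : R)} by exact: cvg_cst.
rewrite /envelope_control; case: ifPn => [/andP[rt1 rtf]|].
  rewrite mulrN1 opprK; apply: near_eq_is_derive (is_derive_rise t).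
  near=> s.
  have r1s : rise s < 1 by near: s; exact: near_lt_continuous cr c1 rt1.
  have rfs : rise s < fall y s by near: s; exact: near_lt_continuous cr cf rtf.
  by rewrite /envelope (min_r (ltW r1s)) (min_l (ltW rfs)).
rewrite negb_and -!leNgt => min_le; case: ifPn => [ft1|].
  have ftr : fall y t < rise t.
    rewrite lt_neqAle eq_sym rf; case/orP: min_le => // r_ge1.
    exact: le_trans (ltW ft1) r_ge1.
  rewrite mulr1; apply: near_eq_is_derive (is_derive_fall y t).
  near=> s.
  have f1s : fall y s < 1 by near: s; exact: near_lt_continuous cf c1 ft1.
  have frs : fall y s < rise s by near: s; exact: near_lt_continuous cf cr ftr.
  by rewrite /envelope min_r// le_min !ltW.
rewrite -leNgt le_eqVlt eq_sym (negbTE f1)/= => ft1.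
have rt1 : 1 < rise t.
  rewrite lt_neqAle eq_sym r1; case/orP: min_le => // f_le_r.
  exact: le_trans (ltW ft1) f_le_r.
rewrite mulr0; apply: near_eq_is_derive (is_derive_cst (1 : R) t 1).
near=> s.
have f1s : 1 < fall y s by near: s; exact: near_lt_continuous c1 cf ft1.
have r1s : 1 < rise s by near: s; exact: near_lt_continuous c1 cr rt1.
by rewrite /envelope (min_l (ltW r1s)) (min_l (ltW f1s)).
Unshelve. all: by end_near. Qed.

Hypothesis x0_bnd : -1 <= x0 <= 1.

Lemma envelope_feasible y : -1 <= y <= 1 -> `|y - x0| <= a * (T - t0) ->
  FP3_feasible a t0 T x0 (envelope y) (envelope_control y).
Proof.
move=> /andP[y_ge y_le]; rewrite ler_norml => /andP[yx0 yx0'].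
case/andP: x0_bnd => x0_ge x0_le.
split.
- apply: (@lipschitz_absolutely_continuous _ _ _ a) => s t _ _.
  exact: envelope_lipschitz.
- apply: measurable_fun_lebesgueR.
  have mr : measurable_fun [set: R] rise.
    apply: continuous_measurable_fun => t.
    exact: is_derive_continuous (is_derive_rise t).
  have mf : measurable_fun [set: R] (fall y).
    apply: continuous_measurable_fun => t.
    exact: is_derive_continuous (is_derive_fall y t).
  apply: measurable_fun_ifT => //.
    by apply: measurable_and; exact: measurable_fun_ltr.
  by apply: measurable_fun_ifT => //; exact: measurable_fun_ltr.
(* The three times at which two of the branches cross. *)
- have := ae_neq_lebesgueR (t0 + (1 - x0) / a).
  have := ae_neq_lebesgueR (T - (1 - y) / a).
  have := ae_neq_lebesgueR ((y - x0 + a * (T + t0)) / (2 * a)).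
  apply: filterS3 => t trf tf tr _; apply: envelope_is_derive.
  + apply: contra_neq tr => tr; rewrite -tr /rise; field; exact: lt0r_neq0.
  + apply: contra_neq tf => tf; rewrite -tf /fall; field; exact: lt0r_neq0.
  + apply: contra_neq trf; rewrite /rise /fall => trf.
    have -> : y = x0 + a * (t - t0) - a * (T - t) by lra.
    by field; exact: lt0r_neq0.
- rewrite /envelope /rise /fall subrr mulr0 addr0 (min_r x0_le) min_l//; lra.
- split.
    apply: aeW => t _; rewrite /envelope_control in_itv/=.
    by case: ifP => _; [|case: ifP => _]; lra.
  move=> t; rewrite in_itv/= => /andP[t0t tT].
  have ? : 0 <= a * (t - t0) by apply: mulr_ge0; [exact: ltW|rewrite subr_ge0].
  have ? : 0 <= a * (T - t) by apply: mulr_ge0; [exact: ltW|rewrite subr_ge0].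
  rewrite /envelope /rise /fall !le_min !ge_min lexx/= !andbT.
  by apply/andP; split; lra.
Qed.

Lemma envelope_end y : y <= 1 -> `|y - x0| <= a * (T - t0) -> envelope y T = y.
Proof.
move=> y1; rewrite ler_norml => /andP[_ yx0].
rewrite /envelope /fall /rise subrr mulr0 addr0 min_r// le_min y1; lra.
Qed.

Lemma feasible_end (x u : R -> R) : FP3_feasible a t0 T x0 x u ->
  -1 <= x T <= 1 /\ `|x T - x0| <= a * (T - t0).
Proof.
move=> Fx; have xC := feasible_lipschitz lambda_gt0 lambda_lt_a Fx.
have [_ _ _ xt0 [_ x1]] := Fx.
have TI : T \in `[t0, T] by rewrite in_itv/= lexx ltW.
have t0I : t0 \in `[t0, T] by rewrite in_itv/= lexx ltW.
split; first exact: x1.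
have := xC T t0 TI t0I; rewrite xt0 => /le_trans; apply.
by rewrite ger0_norm// subr_ge0 ltW.
Qed.

(** The second branch of the minimum comes from the Lipschitz bound between [t0]
    and [t], the third one from the bound between [t] and [T]. *)
Lemma feasible_le_envelope (x u : R -> R) : FP3_feasible a t0 T x0 x u ->
  {in `[t0, T], forall t, x t <= envelope (x T) t}.
Proof.
move=> Fx t tI; have xC := feasible_lipschitz lambda_gt0 lambda_lt_a Fx.
have [_ _ _ xt0 [_ x1]] := Fx.
have TI : T \in `[t0, T] by rewrite in_itv/= lexx ltW.
have t0I : t0 \in `[t0, T] by rewrite in_itv/= lexx ltW.
have := xC t t0 tI t0I; have := xC t T tI TI; have := x1 t tI.
move: tI; rewrite in_itv/= => /andP[t0t tT] /andP[_ xt1].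
rewrite (distrC t T) (ger0_norm (_ : 0 <= T - t)) ?subr_ge0//.
rewrite (ger0_norm (_ : 0 <= t - t0)) ?subr_ge0// xt0.
move=> /(le_trans (ler_norm _)) ? /(le_trans (ler_norm _)) ?.
by rewrite /envelope /rise /fall !le_min xt1/=; apply/andP; split; lra.
Qed.

Lemma envelope_discounted_integrable y :
  (leb R).-integrable (`[t0, T]%classic : set (lebesgueR R))
    (EFin \o (fun t => expR (- lambda * t) * envelope y t)).
Proof.
apply: continuous_integrable_lebesgueR => t.
apply: cvgM; first exact: continuous_discount.
exact: (lipschitz_continuous (envelope_lipschitz y)).
Qed.

(** The value of the cost at the envelope with endpoint [y]; as a formula it
    makes sense, and is continuous, for all real [y]. *)
Definition endpoint_cost (y : R) : R :=
  (expR (- lambda * T) * y - expR (- lambda * t0) * x0) / a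
    - (1 - lambda / a) * discounted_area lambda t0 T (envelope y).

(** Moving the endpoint by [d] moves the envelope by at most [d] uniformly in
    time. *)
Lemma endpoint_cost_continuous : continuous endpoint_cost.
Proof.
pose K := discounted_area lambda t0 T (cst 1).
have mD : measurable (`[t0, T]%classic : set (lebesgueR R)).
  exact: measurable_lebesgueR.
have ie : (leb R).-integrable (`[t0, T]%classic : set (lebesgueR R))
    (EFin \o (fun t => expR (- lambda * t) * 1)).
  apply: continuous_integrable_lebesgueR => t; apply: cvgM; last exact: cvg_cst.
  exact: continuous_discount.
have areaC y z : discounted_area lambda t0 T (envelope y) -
    discounted_area lambda t0 T (envelope z) <= K * `|y - z|.
  have iey := envelope_discounted_integrable y.
  have iez := envelope_discounted_integrable z.
  rewrite /K /discounted_area -RintegralB// -RintegralZr//.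
  apply: le_Rintegral => //.
  - have := integrableB mD iey iez; exact.
  - have := integrableZr mD `|y - z| ie; exact.
  move=> t _; rewrite -mulrBr mulr1 ler_wpM2l ?expR_ge0//.
  exact: le_trans (ler_norm _) (envelope_lipschitz_endpoint y z t).
have area_cont : continuous (fun y => discounted_area lambda t0 T (envelope y)).
  apply: (@lipschitz_continuous _ K) => y z; rewrite ler_norml areaC andbT.
  by rewrite lerNl opprB distrC areaC.
move=> y; apply: cvgB.
  apply: cvgM; last exact: cvg_cst.
  apply: cvgB; last exact: cvg_cst.
  by apply: cvgM; [exact: cvg_cst|exact: cvg_id].
by apply: cvgM; [exact: cvg_cst|exact: area_cont].
Qed.

End envelope.

(** * Existence of a minimizer *)

Theorem mainTheorem7 (R : realType) (a lambda t0 T x0 : R)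
    (hlambda : 0 < lambda) (ha : lambda < a)
    (ht0 : 0 <= t0) (hT : t0 < T)
    (hx0 : x0 \in `[-1, 1]) :
  exists x u : R -> R, FP3_W11_global_minimizer a lambda t0 T x0 x u.
Proof.
have a_gt0 : 0 < a := lt_trans hlambda ha.
move: hx0; rewrite in_itv/= => x0_bnd.
have reach_ge0 : 0 <= a * (T - t0).
  by apply: mulr_ge0; [exact: ltW|rewrite subr_ge0 ltW].
(* The endpoints that some feasible trajectory reaches. *)
pose lo := Num.max (-1) (x0 - a * (T - t0)).
pose hi := Num.min 1 (x0 + a * (T - t0)).
have reachE y : (y \in `[lo, hi]) =
    (-1 <= y <= 1) && (`|y - x0| <= a * (T - t0)).
  rewrite in_itv/= ge_max le_min ler_norml.
  by apply/idP/idP => /andP[/andP[? ?] /andP[? ?]]; rewrite -!andbA;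
    do !(apply/andP; split); lra.
have lo_hi : lo <= hi.
  rewrite ge_max !le_min; case/andP: x0_bnd => ? ?.
  by do !(apply/andP; split); lra.
have [y yI ymin] := EVT_min lo_hi (continuous_subspaceT
  (@endpoint_cost_continuous R a lambda t0 T x0 hlambda ha)).
move: (yI); rewrite reachE => /andP[y1 yx0].
have Fy := envelope_feasible hlambda ha x0_bnd y1 yx0.
exists (envelope a t0 T x0 y), (envelope_control a t0 T x0 y).
split => // x u Fx.
rewrite (feasible_costE hlambda ha ht0 hT Fy).
rewrite (feasible_costE hlambda ha ht0 hT Fx).
rewrite lee_fin (envelope_end _ yx0); last by case/andP: y1.
have [xT1 xTx0] := feasible_end hlambda ha hT Fx.
have xTI : x T \in `[lo, hi] by rewrite reachE xT1.
apply: (le_trans (ymin _ xTI)); rewrite /endpoint_cost lerD2l lerN2.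
apply: ler_wpM2l.
  by rewrite subr_ge0 ler_pdivrMr// mul1r ltW.
apply: le_Rintegral.
- exact: measurable_lebesgueR.
- exact: (discounted_integrable hlambda ha ht0 hT
    (feasible_lipschitz hlambda ha Fx) (feasible_bounded Fx)).
- exact: envelope_discounted_integrable.
- move=> t tI; rewrite ler_wpM2l ?expR_ge0//.
  exact: (feasible_le_envelope hlambda ha hT Fx).
Qed.
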